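(* Let $M$ be a right $Com$-module with canonical increasing filtration $F_1M\to F_2M\to\cdots$ and maps $g_n:F_nM\to M$. If $n\ge r$, then $g_n:(F_nM)(r)\to M(r)$ is an isomorphism.
   Context: $Sp$ is the category of symmetric spectra, with smash product $\wedge$ and unit $\mathbb S$. For symmetric sequences $M,N$ in $Sp$ set $(M\otimes N)(n)=\bigvee_{l+m=n}\Sigma_{n+}\wedge_{\Sigma_l\times\Sigma_m}(M(l)\wedge N(m))$ and $(M\circ N)(n)=\bigvee_{r\ge 0}M(r)\wedge_{\Sigma_r}N^{\otimes r}(n)$; operads are monoids for $\circ$. $Com=( *,\mathbb S,\mathbb S,\dots)$ is the reduced commutative operad, with identity structure maps. Right $Com$-modules $M$ are required to satisfy $M(0)=*$; equivalently they are functors $\mathrm{Epi}^{op}\to Sp$, where $\mathrm{Epi}$ has objects $\mathbf n=\{1,\dots,n\}$, $n\ge1$, and morphisms the surjections. For a spectrum $X$ with $\Sigma_n$-action, $i_n(X)$ is the symmetric sequence equal to $X$ in degree $n$ and $*$ elsewhere. The free right module is $i_n(X)\circ Com=X\wedge_{\Sigma_n}P_n$, where $P_n(r)=\mathrm{Epi}(\mathbf r,\mathbf n)_+\wedge\mathbb S$. For a right $Com$-module $M$, the inclusion $i_n(M(n))\to M$ induces a map of right $Com$-modules $e_n:i_n(M(n))\circ Com\to M$. The canonical increasing filtration of $M$ consists of right $Com$-modules $F_nM$ with maps $f_n:F_nM\to F_{n+1}M$ and $g_n:F_nM\to M$ satisfying $g_{n+1}f_n=g_n$, defined recursively: $F_1M=i_1(M(1))\circ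 Com$ and $g_1=e_1$. For $n>1$, $F_nM$ is the pushout in right $Com$-modules of $i_n(M(n))\circ Com\leftarrow i_n((F_{n-1}M)(n))\circ Com\xrightarrow{e_n}F_{n-1}M$, where the left map is induced by $g_{n-1}$; $f_{n-1}:F_{n-1}M\to F_nM$ is the structure map of the pushout, and $g_n:F_nM\to M$ is the map induced by $g_{n-1}$ and $e_n:i_n(M(n))\circ Com\to M$. *)

(* Defs.v *)
From mathcomp Require Import all_boot all_fingroup.
From mathcomp Require Import boolp.

Set Implicit Arguments.
Unset Strict Implicit.
Unset Printing Implicit Defensive.

Declare Scope cat_scope.
Delimit Scope cat_scope with cat.
Local Open Scope cat_scope.

Record category := Category {
  ob :> Type;
  hom : ob -> ob -> Type;
  idm : forall a, hom a a;
  cmp : forall a b c, hom b c -> hom a b -> hom a c;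
  cmpA : forall a b c d (h : hom c d) (g : hom b c) (f : hom a b),
    cmp h (cmp g f) = cmp (cmp h g) f;
  cmp1m : forall a b (f : hom a b), cmp (idm b) f = f;
  cmpm1 : forall a b (f : hom a b), cmp f (idm a) = f }.

Arguments hom {_} _ _.
Arguments idm {_} _.
Arguments cmp {_ _ _ _} _ _.

Notation "g \oc f" := (cmp g f)
  (at level 50, left associativity, format "g  \oc  f") : cat_scope.

Definition is_iso (C : category) (a b : C) (f : hom a b) : Prop :=
  exists g : hom b a, g \oc f = idm a /\ f \oc g = idm b.

Definition op (C : category) : category.
Proof.
exists C (fun a b => @hom C b a) (fun a => idm a) (fun a b c g f => f \oc g).
- by move=> a b c d h g f; rewrite cmpA.
- by move=> a b f; rewrite cmpm1.
- by move=> a b f; rewrite cmp1m.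
Defined.

Record functor (C D : category) := Functor {
  fob :> C -> D;
  fmap : forall a b, hom a b -> hom (fob a) (fob b);
  fmap1 : forall a, fmap (idm a) = idm (fob a);
  fmapM : forall a b c (g : hom b c) (f : hom a b),
    fmap (g \oc f) = fmap g \oc fmap f }.

Arguments fmap {C D} _ {a b} _.

Record nat_trans (C D : category) (F G : functor C D) := NatTrans {
  component :> forall a, hom (F a) (G a);
  naturality : forall a b (f : hom a b),
    component b \oc fmap F f = fmap G f \oc component a }.

Lemma nat_transP C D (F G : functor C D) (s t : nat_trans F G) :
  (forall a, s a = t a) -> s = t.
Proof.
case: s t => s ns [t nt] /= st.
have E : s = t by apply: functional_extensionality_dep.
by rewrite {}E in ns st *; congr NatTrans; exact: Prop_irrelevance.
Qed.

Definition nat_id C D (F : functor C D) : nat_trans F F.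
Proof. by exists (fun a => idm (F a)) => a b f; rewrite cmp1m cmpm1. Defined.

Definition nat_cmp C D (F G H : functor C D) (t : nat_trans G H)
  (s : nat_trans F G) : nat_trans F H.
Proof.
exists (fun a => t a \oc s a) => a b f.
by rewrite -cmpA naturality cmpA naturality cmpA.
Defined.

Definition functor_cat (C D : category) : category.
Proof.
exists (functor C D) (@nat_trans C D) (@nat_id C D) (@nat_cmp C D).
- by move=> *; apply: nat_transP => a /=; rewrite cmpA.
- by move=> *; apply: nat_transP => a /=; rewrite cmp1m.
- by move=> *; apply: nat_transP => a /=; rewrite cmpm1.
Defined.

Notation presheaf C D := (functor_cat (op C) D).

(* Diagrams are shaped by a graph: a diagram on a small category has the same
   cocones as its restriction to the underlying graph. *)
Record diagram (C : category) := Diagram {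
  vert : Type;
  edge : Type;
  src : edge -> vert;
  tgt : edge -> vert;
  dob : vert -> C;
  dmap : forall e, hom (dob (src e)) (dob (tgt e)) }.

Arguments dob {C} D _ : rename.
Arguments dmap {C} D _ : rename.

Definition is_cocone C (D : diagram C) (z : C) (l : forall i, hom (dob D i) z) :=
  forall e, l (tgt e) \oc dmap D e = l (src e).

Record colimit C (D : diagram C) := Colimit {
  colim :> C;
  leg : forall i, hom (dob D i) colim;
  leg_cocone : is_cocone leg;
  desc : forall (z : C) (l : forall i, hom (dob D i) z),
    is_cocone l -> hom colim z;
  desc_leg : forall z l (cl : @is_cocone C D z l) i, desc cl \oc leg i = l i;
  desc_uniq : forall z (u v : hom colim z),
    (forall i, u \oc leg i = v \oc leg i) -> u = v }.

Definition cocomplete (C : category) := forall D : diagram C, colimit D.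

Section FunctorColimits.
Variables (C D : category) (hD : cocomplete D) (X : diagram (functor_cat C D)).

Definition eval_diagram (a : C) : diagram D :=
  @Diagram D (vert X) (edge X) (@src _ X) (@tgt _ X)
    (fun i => (dob X i : functor C D) a)
    (fun e => (dmap X e : nat_trans _ _) a).

Lemma functor_colim_cocone a b (f : @hom C a b) :
  @is_cocone D (eval_diagram a) (hD (eval_diagram b))
    (fun i => leg (hD (eval_diagram b)) i \oc fmap (dob X i : functor C D) f).
Proof.
move=> e /=; rewrite -cmpA -(naturality (dmap X e)) cmpA.
by congr (_ \oc _); exact: (leg_cocone (hD (eval_diagram b)) e).
Qed.

Definition functor_colim : functor C D.
Proof.
exists (fun a => hD (eval_diagram a) : D)
       (fun a b (f : hom a b) => desc (hD (eval_diagram a)) (functor_colim_cocone f)).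
- move=> a; apply: desc_uniq => i.
  by rewrite desc_leg fmap1 cmpm1 cmp1m.
- move=> a b c g f; apply: desc_uniq => i.
  by rewrite -cmpA !desc_leg cmpA desc_leg fmapM cmpA.
Defined.

Definition functor_leg (i : vert X) : nat_trans (dob X i) functor_colim.
Proof.
exists (fun a => leg (hD (eval_diagram a)) i) => a b f.
exact: (esym (desc_leg (hD (eval_diagram a)) (functor_colim_cocone f) i)).
Defined.

Lemma functor_cocone_at (z : functor C D)
    (l : forall i, @hom (functor_cat C D) (dob X i) z) (cl : is_cocone l) a :
  @is_cocone D (eval_diagram a) (z a) (fun i => (l i : nat_trans _ _) a).
Proof. by move=> e /=; rewrite -(cl e). Qed.

Definition functor_desc (z : functor C D)
    (l : forall i, @hom (functor_cat C D) (dob X i) z) (cl : is_cocone l) :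
  nat_trans functor_colim z.
Proof.
exists (fun a => desc (hD (eval_diagram a)) (@functor_cocone_at z l cl a)) => a b f /=.
have E c i := desc_leg (hD (eval_diagram c)) (@functor_cocone_at z l cl c) i.
apply: desc_uniq => i; rewrite -!cmpA [in RHS]E.
rewrite (desc_leg (hD (eval_diagram a)) (functor_colim_cocone f) i) cmpA.
rewrite -(naturality (l i)); congr (_ \oc _); exact: E.
Defined.

Definition functor_cat_colimit : colimit X.
Proof.
exists functor_colim functor_leg functor_desc.
- move=> e; apply: nat_transP => a; exact: (leg_cocone (hD (eval_diagram a)) e).
- move=> z l cl i; apply: nat_transP => a.
  exact: (desc_leg (hD (eval_diagram a)) (@functor_cocone_at z l cl a) i).
- move=> z u v uv; apply: nat_transP => a; apply: desc_uniq => i.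
  exact: (congr1 (fun t : nat_trans _ _ => t a) (uv i)).
Defined.

End FunctorColimits.

Definition functor_cat_cocomplete C D (hD : cocomplete D) :
  cocomplete (functor_cat C D) := functor_cat_colimit hD.

Section Pushouts.
Variables (C : category) (hC : cocomplete C).
Variables (a b c : C) (u : hom a b) (v : hom a c).

Definition span_ob (i : option bool) : C :=
  match i with None => a | Some true => b | Some false => c end.

Definition span_diagram : diagram C :=
  @Diagram C (option bool) bool (fun _ => None) Some span_ob
    (fun e => match e return hom a (span_ob (Some e)) with
              | true => u | false => v end).

Definition pushout : C := hC span_diagram.
Definition po_inl : hom b pushout := leg (hC span_diagram) (Some true).
Definition po_inr : hom c pushout := leg (hC span_diagram) (Some false).

Lemma po_comm : po_inl \oc u = po_inr \oc v.
Proof.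
by rewrite [LHS](leg_cocone (hC span_diagram) true)
           [RHS](leg_cocone (hC span_diagram) false).
Qed.

Section Desc.
Variables (z : C) (f : hom b z) (g : hom c z) (fg : f \oc u = g \oc v).

Definition span_leg (i : option bool) : hom (span_ob i) z :=
  match i with None => f \oc u | Some true => f | Some false => g end.

Lemma span_leg_cocone : @is_cocone C span_diagram z span_leg.
Proof. by case. Qed.

Definition po_desc : hom pushout z := desc (hC span_diagram) span_leg_cocone.

Lemma po_desc_inl : po_desc \oc po_inl = f.
Proof. exact: (desc_leg (hC span_diagram) span_leg_cocone (Some true)). Qed.

Lemma po_desc_inr : po_desc \oc po_inr = g.
Proof. exact: (desc_leg (hC span_diagram) span_leg_cocone (Some false)). Qed.

End Desc.

Lemma po_desc_uniq (z : C) (s t : hom pushout z) :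
  s \oc po_inl = t \oc po_inl -> s \oc po_inr = t \oc po_inr -> s = t.
Proof.
move=> el er; apply: desc_uniq => -[[]|] //.
rewrite -(leg_cocone (hC span_diagram) true) !cmpA.
by congr (_ \oc _).
Qed.

End Pushouts.

Section Quotients.
Variables (T : Type) (R : T -> T -> Prop).

Inductive eqv_gen : T -> T -> Prop :=
| eqv_step x y : R x y -> eqv_gen x y
| eqv_refl x : eqv_gen x x
| eqv_sym x y : eqv_gen x y -> eqv_gen y x
| eqv_trans x y z : eqv_gen x y -> eqv_gen y z -> eqv_gen x z.

Definition quot : Type := {P : T -> Prop | exists x, P = eqv_gen x}.

Definition qpi (x : T) : quot := exist _ (eqv_gen x) (ex_intro _ x erefl).

Lemma qpi_sound x y : R x y -> qpi x = qpi y.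
Proof.
move=> Rxy; apply: eq_exist; apply: funext => z; apply: propext; split.
- by apply: eqv_trans; apply: eqv_sym; exact: eqv_step.
- by apply: eqv_trans; exact: eqv_step.
Qed.

Lemma qpi_surj (q : quot) : exists x, qpi x = q.
Proof. by case: q => P [x Px]; exists x; apply: eq_exist. Qed.

Lemma qpi_eqv x y : qpi x = qpi y -> eqv_gen x y.
Proof.
by move=> /(congr1 sval) /= E; rewrite E; exact: eqv_refl.
Qed.

Definition qrepr (q : quot) : T := sval (cid (qpi_surj q)).

Definition qlift S (f : T -> S) (Hf : forall x y, R x y -> f x = f y)
  (q : quot) : S := f (qrepr q).

Lemma qlift_pi S (f : T -> S) Hf x : @qlift S f Hf (qpi x) = f x.
Proof.
rewrite /qlift /qrepr; case: (cid _) => y /= /qpi_eqv.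
by elim=> // a b c _ -> _ ->.
Qed.

End Quotients.

Record pset := PSet { pcar :> Type; pt : pcar }.
Arguments pt {_}.

Record phom (A B : pset) := PHom { pfun :> A -> B; pfun_pt : pfun pt = pt }.

Lemma phomP (A B : pset) (f g : phom A B) : (forall x, f x = g x) -> f = g.
Proof.
case: f g => f fp [g gp] /= fg; have E : f = g by apply: funext.
by rewrite {}E in fp fg *; congr PHom; exact: Prop_irrelevance.
Qed.

Definition pid (A : pset) : phom A A := @PHom A A id erefl.

Definition pcmp (A B C : pset) (g : phom B C) (f : phom A B) : phom A C.
Proof. by exists (g \o f) => /=; rewrite !pfun_pt. Defined.

Definition pset_cat : category.
Proof.
by exists pset phom pid pcmp => *; apply: phomP.
Defined.

Definition pconst (A B : pset) : phom A B := @PHom A B (fun _ => pt) erefl.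

Section PSetColimits.
Variable D : diagram pset_cat.

(* [None] is the base point; it is needed for the empty diagram. *)
Definition pset_colim_pre : Type := option {i : vert D & (dob D i : pset)}.

Definition pset_in (i : vert D) (x : (dob D i : pset)) : pset_colim_pre :=
  Some (existT (fun i => (dob D i : pset) : Type) i x).

Inductive pset_colim_rel : pset_colim_pre -> pset_colim_pre -> Prop :=
| pset_colim_pt i : pset_colim_rel None (@pset_in i pt)
| pset_colim_edge e (x : (dob D (src e) : pset)) :
    pset_colim_rel (pset_in x) (pset_in ((dmap D e : phom _ _) x)).

Definition pset_colim : pset := @PSet (quot pset_colim_rel) (qpi _ None).

Definition pset_leg (i : vert D) : phom (dob D i) pset_colim.
Proof.
exists (fun x => qpi pset_colim_rel (pset_in x)).
by apply: esym; apply: qpi_sound; constructor.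
Defined.

Lemma pset_colim_ind (P : pset_colim -> Prop) :
  P pt -> (forall i x, P (pset_leg i x)) -> forall q, P q.
Proof.
move=> P0 P1 q; have [[[i x]|] <-] := qpi_surj q; [exact: P1|exact: P0].
Qed.

Section Desc.
Variables (z : pset) (l : forall i, phom (dob D i) z).
Hypothesis cl : @is_cocone pset_cat D z l.

Definition pset_desc_pre (q : pset_colim_pre) : z :=
  if q is Some (existT i x) then l i x else pt.

Lemma pset_desc_compat x y :
  pset_colim_rel x y -> pset_desc_pre x = pset_desc_pre y.
Proof.
case=> [i|e w] /=; first by rewrite pfun_pt.
exact: (esym (congr1 (fun t : phom _ _ => t w) (cl e))).
Qed.

Definition pset_desc : phom pset_colim z.
Proof. by exists (qlift pset_desc_compat); rewrite qlift_pi. Defined.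

End Desc.

Definition pset_colimit : colimit D.
Proof.
exists pset_colim pset_leg pset_desc.
- by move=> e; apply: phomP => x /=; apply/esym/qpi_sound; constructor.
- by move=> z l cl i; apply: phomP => x /=; rewrite qlift_pi.
- move=> z u v uv; apply: phomP; apply: pset_colim_ind.
    by rewrite (pfun_pt u) (pfun_pt v).
  by move=> i x; exact: (congr1 (fun t : phom _ _ => t x) (uv i)).
Defined.

End PSetColimits.

Definition pset_cocomplete : cocomplete pset_cat := pset_colimit.

Record mono_map (m n : nat) := MonoMap {
  mono_fun :> 'I_m.+1 -> 'I_n.+1;
  mono_le : forall i j : 'I_m.+1, i <= j -> mono_fun i <= mono_fun j }.

Lemma mono_mapP m n (f g : mono_map m n) : (forall i, f i = g i) -> f = g.
Proof.
case: f g => f fp [g gp] /= fg; have E : f = g by apply: funext.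
by rewrite {}E in fp fg *; congr MonoMap; exact: Prop_irrelevance.
Qed.

Definition mono_id n : mono_map n n := @MonoMap n n id (fun _ _ => id).

Definition mono_cmp m n p (g : mono_map n p) (f : mono_map m n) :
  mono_map m p.
Proof. by exists (g \o f) => i j ij /=; do 2! apply: mono_le. Defined.

Definition Delta : category.
Proof. by exists nat mono_map mono_id mono_cmp => *; apply: mono_mapP. Defined.

Definition sSet : category := presheaf Delta pset_cat.

Definition sSet_cocomplete : cocomplete sSet :=
  functor_cat_cocomplete pset_cocomplete.

Definition simplices (X : sSet) (k : nat) : pset := (X : functor _ _) k.

Definition sact (X : sSet) k l (f : mono_map k l) :
  phom (simplices X l) (simplices X k) := @fmap (op Delta) _ X l k f.

Definition sapp (X Y : sSet) (f : hom X Y) k :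
  phom (simplices X k) (simplices Y k) := (f : nat_trans _ _) k.

Arguments sact : simpl never.
Arguments sapp : simpl never.

Lemma sapp_nat (X Y : sSet) (f : hom X Y) k l (g : mono_map k l) x :
  sapp f k (sact X g x) = sact Y g (sapp f l x).
Proof.
exact: (congr1 (fun t : phom _ _ => t x)
          (@naturality (op Delta) _ _ _ f l k g)).
Qed.

Lemma sSet_homP (X Y : sSet) (f g : hom X Y) :
  (forall k x, sapp f k x = sapp g k x) -> f = g.
Proof. by move=> fg; apply: nat_transP => k; apply: phomP => x; exact: fg. Qed.

Lemma sact1 (X : sSet) k x : sact X (mono_id k) x = x.
Proof. exact: (congr1 (fun t : phom _ _ => t x) (@fmap1 (op Delta) _ X k)). Qed.

Lemma sactM (X : sSet) k l m (g : mono_map l m) (f : mono_map k l) x :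
  sact X (mono_cmp g f) x = sact X f (sact X g x).
Proof.
exact: (congr1 (fun t : phom _ _ => t x) (@fmapM (op Delta) _ X m l k f g)).
Qed.

(* The circle is Delta[1] modulo its boundary, whose simplices are the
   constant maps. *)
Definition is_const k (a : mono_map k 1) := forall i j, a i = a j.

Definition circle_rel k (a b : mono_map k 1) := is_const a /\ is_const b.

Definition mono_const k : mono_map k 1 :=
  @MonoMap k 1 (fun _ => ord0) (fun _ _ _ => leqnn _).

Definition circle_simplices k : pset :=
  @PSet (quot (@circle_rel k)) (qpi _ (mono_const k)).

Lemma circle_act_compat k l (f : mono_map k l) (a b : mono_map l 1) :
  circle_rel a b -> qpi (@circle_rel k) (mono_cmp a f) = qpi _ (mono_cmp b f).
Proof.
move=> [ca cb]; apply: qpi_sound; split=> i j /=; [exact: ca|exact: cb].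
Qed.

Definition circle_act k l (f : mono_map k l) :
  phom (circle_simplices l) (circle_simplices k).
Proof.
exists (qlift (circle_act_compat f)).
by rewrite qlift_pi; apply: qpi_sound.
Defined.

Definition circle : sSet.
Proof.
exists circle_simplices (fun l k (f : mono_map k l) => circle_act f).
- move=> k; apply: phomP => q; have [a <-] := qpi_surj q.
  by rewrite /= qlift_pi; congr qpi; apply: mono_mapP.
- move=> a b c g f; apply: phomP => q; have [d <-] := qpi_surj q.
  by rewrite /= !qlift_pi; congr qpi; apply: mono_mapP.
Defined.

Section Smash.
Variables A B : pset.

Definition wedge_pt (p : A * B) := p.1 = pt \/ p.2 = pt.

Definition smash_rel (p q : A * B) := wedge_pt p /\ wedge_pt q.

Definition psmash : pset := @PSet (quot smash_rel) (qpi _ (pt, pt)).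

Definition spair (a : A) (b : B) : psmash := qpi smash_rel (a, b).

Lemma spair_ptl b : spair pt b = pt.
Proof. by apply: qpi_sound; split; left. Qed.

Lemma spair_ptr a : spair a pt = pt.
Proof. by apply: qpi_sound; split; [right|left]. Qed.

Lemma spair_surj (q : psmash) : exists a b, spair a b = q.
Proof. by have [[a b] <-] := qpi_surj q; exists a, b. Qed.

Section Lift.
Variables (Z : pset) (f : A -> B -> Z).
Hypotheses (fl : forall b, f pt b = pt) (fr : forall a, f a pt = pt).

Lemma smash_lift_compat (p q : A * B) :
  smash_rel p q -> f p.1 p.2 = f q.1 q.2.
Proof. by move=> [[]-> []->]; rewrite ?fl ?fr. Qed.

Definition smash_lift : phom psmash Z.
Proof. by exists (qlift smash_lift_compat); rewrite qlift_pi. Defined.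

Lemma smash_liftE a b : smash_lift (spair a b) = f a b.
Proof. exact: qlift_pi. Qed.

End Lift.
End Smash.

Definition psmash_map (A B A' B' : pset) (f : phom A A') (g : phom B B') :
  phom (psmash A B) (psmash A' B').
Proof.
apply: (@smash_lift A B (psmash A' B') (fun a b => spair (f a) (g b))).
- by move=> b; rewrite pfun_pt spair_ptl.
- by move=> a; rewrite pfun_pt spair_ptr.
Defined.

Arguments psmash_map : simpl never.

Lemma psmash_mapE A B A' B' (f : phom A A') (g : phom B B') a b :
  psmash_map f g (spair a b) = spair (f a) (g b).
Proof. exact: smash_liftE. Qed.

Definition smash (X Y : sSet) : sSet.
Proof.
exists (fun k : op Delta => psmash (simplices X k) (simplices Y k) : pset_cat)
       (fun l k (f : mono_map k l) => psmash_map (sact X f) (sact Y f)).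
- move=> k; apply: phomP => q; have [a [b <-]] := spair_surj q.
  by rewrite [LHS]psmash_mapE; congr spair; exact: sact1.
- move=> m l k f g; apply: phomP => q; have [a [b <-]] := spair_surj q.
  have E u v (h : mono_map u v) := psmash_mapE (sact X h) (sact Y h).
  rewrite [LHS]E [RHS](congr1 _ (E _ _ _ _ _)) [RHS]E.
  by congr spair; exact: sactM.
Defined.

Definition smash_map (X Y X' Y' : sSet) (f : hom X X') (g : hom Y Y') :
  hom (smash X Y) (smash X' Y').
Proof.
exists (fun k => psmash_map (sapp f k) (sapp g k)).
move=> l k h; apply: phomP => q; have [a [b <-]] := spair_surj q.
rewrite [LHS](congr1 _ (psmash_mapE _ _ _ _)) [LHS]psmash_mapE.
rewrite [RHS](congr1 _ (psmash_mapE _ _ _ _)) [RHS]psmash_mapE.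
by congr spair; exact: sapp_nat.
Defined.

Lemma smash_sactE (X Y : sSet) k l (f : mono_map k l) (a : simplices X l)
    (b : simplices Y l) :
  sact (smash X Y) f (spair a b) = spair (sact X f a) (sact Y f b).
Proof. exact: psmash_mapE. Qed.

Lemma smash_mapE (X Y X' Y' : sSet) (f : hom X X') (g : hom Y Y') k
    (a : simplices X k) (b : simplices Y k) :
  sapp (smash_map f g) k (spair a b) = spair (sapp f k a) (sapp g k b).
Proof. exact: psmash_mapE. Qed.

Lemma sapp_cmp (X Y Z : sSet) (g : hom Y Z) (f : hom X Y) k x :
  sapp (g \oc f) k x = sapp g k (sapp f k x).
Proof. by []. Qed.

(* The block permutation of {0, ..., p + m - 1} that acts by [t] on the first
   p elements and by [r] on the last m ones. *)
Definition block_fun p m (t : 'S_p) (r : 'S_m) (i : 'I_(p + m)) : 'I_(p + m) :=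
  match split i with inl a => lshift m (t a) | inr b => rshift p (r b) end.

Lemma block_fun_inj p m (t : 'S_p) (r : 'S_m) : injective (block_fun t r).
Proof.
apply: (can_inj (g := block_fun t^-1 r^-1)) => i.
rewrite /block_fun -{2}(splitK i); case: (split i) => j /=.
- by rewrite -/(unsplit (inl _)) unsplitK permK.
- by rewrite -/(unsplit (inr _)) unsplitK permK.
Qed.

Definition block_perm p m (t : 'S_p) (r : 'S_m) : 'S_(p + m) :=
  perm (@block_fun_inj p m t r).

Section StructureMaps.
Variables (X : nat -> sSet) (sigma : forall m, hom (smash circle (X m)) (X m.+1)).

(* The iterated structure map S^p /\ X_m -> X_(p + m), evaluated at
   s_0 /\ ... /\ s_(p-1) /\ x. *)
Fixpoint sigma_iter k p m :
  ('I_p -> simplices circle k) -> simplices (X m) k -> simplices (X (p + m)) k :=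
  match p with
  | 0 => fun _ x => x
  | q.+1 => fun s x =>
      sapp (sigma (q + m)) k
        (spair (s ord0) (sigma_iter (fun i => s (lift ord0 i)) x))
  end.

End StructureMaps.

(* [perm_act] is a left action of the symmetric group: the MathComp product
   [s * t] of permutations is the composite "first s, then t".  Likewise the
   left action of [t] on S^p moves the i-th factor to the place [t i]. *)
Record spectrum := Spectrum {
  level :> nat -> sSet;
  perm_act : forall m, 'S_m -> hom (level m) (level m);
  perm_act1 : forall m, perm_act (1%g : 'S_m) = idm (level m);
  perm_actM : forall m (s t : 'S_m),
    perm_act (s * t)%g = perm_act t \oc perm_act s;
  sigma : forall m, hom (smash circle (level m)) (level m.+1);
  sigma_equivariant : forall k p m (t : 'S_p) (r : 'S_m)
      (s : 'I_p -> simplices circle k) (x : simplices (level m) k),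
    sigma_iter sigma (fun i => s ((t^-1)%g i)) (sapp (perm_act r) k x) =
    sapp (perm_act (block_perm t r)) k (sigma_iter sigma s x) }.

Record spectrum_hom (X Y : spectrum) := SpectrumHom {
  at_level :> forall m, hom (X m) (Y m);
  at_level_equivariant : forall m (s : 'S_m),
    at_level m \oc perm_act X s = perm_act Y s \oc at_level m;
  at_level_sigma : forall m,
    at_level m.+1 \oc sigma X m =
    sigma Y m \oc smash_map (idm circle) (at_level m) }.

Lemma spectrum_homP (X Y : spectrum) (f g : spectrum_hom X Y) :
  (forall m, f m = g m) -> f = g.
Proof.
case: f g => f f1 f2 [g g1 g2] /= fg.
have E : f = g by apply: functional_extensionality_dep.
rewrite {}E in f1 f2 fg *.
by congr SpectrumHom; exact: Prop_irrelevance.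
Qed.

Lemma smash_map1 (X Y : sSet) :
  smash_map (idm X) (idm Y) = idm (smash X Y).
Proof.
apply: sSet_homP => k q; have [a [b <-]] := spair_surj q.
by rewrite smash_mapE.
Qed.

Lemma smash_map_cmp (X Y Y' Y'' : sSet) (g : hom Y' Y'') (f : hom Y Y') :
  smash_map (idm X) (g \oc f) = smash_map (idm X) g \oc smash_map (idm X) f.
Proof.
apply: sSet_homP => k q; have [a [b <-]] := spair_surj q.
by rewrite sapp_cmp !smash_mapE.
Qed.

Definition spectrum_id (X : spectrum) : spectrum_hom X X.
Proof.
exists (fun m => idm (X m)) => *; first by rewrite cmp1m cmpm1.
by rewrite smash_map1 cmp1m cmpm1.
Defined.

Definition spectrum_cmp (X Y Z : spectrum) (g : spectrum_hom Y Z)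
  (f : spectrum_hom X Y) : spectrum_hom X Z.
Proof.
exists (fun m => g m \oc f m) => m *.
- by rewrite -cmpA at_level_equivariant cmpA at_level_equivariant cmpA.
- by rewrite -cmpA at_level_sigma cmpA at_level_sigma smash_map_cmp cmpA.
Defined.

Definition Sp : category.
Proof.
exists spectrum spectrum_hom spectrum_id spectrum_cmp.
- by move=> *; apply: spectrum_homP => m; exact: cmpA.
- by move=> *; apply: spectrum_homP => m; exact: cmp1m.
- by move=> *; apply: spectrum_homP => m; exact: cmpm1.
Defined.

Lemma sapp_pt (X Y : sSet) (f : hom X Y) k : sapp f k pt = pt.
Proof. exact: pfun_pt. Qed.

Section SpectrumColimits.
Variable D : diagram Sp.

Let X (i : vert D) : spectrum := dob D i.
Let phi (e : edge D) : spectrum_hom (X (src e)) (X (tgt e)) := dmap D e.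

Definition level_diagram (m : nat) : diagram sSet :=
  @Diagram sSet (vert D) (edge D) (@src _ D) (@tgt _ D)
    (fun i => X i m) (fun e => phi e m).

Definition spc_level (m : nat) : colimit (level_diagram m) :=
  sSet_cocomplete (level_diagram m).

Definition spc_leg m (i : vert D) : hom (X i m) (spc_level m) :=
  leg (spc_level m) i.

Lemma spc_leg_edge m k (e : edge D) (x : simplices (X (src e) m) k) :
  sapp (spc_leg m (tgt e)) k (sapp (phi e m) k x) = sapp (spc_leg m (src e)) k x.
Proof. by rewrite -sapp_cmp [_ \oc _](leg_cocone (spc_level m) e). Qed.

Lemma spc_ind m k (P : simplices (spc_level m) k -> Prop) :
  P pt -> (forall i x, P (sapp (spc_leg m i) k x)) -> forall q, P q.
Proof. exact: (@pset_colim_ind (eval_diagram (level_diagram m) k) P). Qed.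

Lemma spc_perm_cocone m (s : 'S_m) :
  @is_cocone _ (level_diagram m) (spc_level m)
    (fun i => spc_leg m i \oc perm_act (X i) s).
Proof.
move=> e; apply: sSet_homP => k x.
rewrite [LHS]sapp_cmp [LHS]sapp_cmp [RHS]sapp_cmp -spc_leg_edge.
apply: congr1; rewrite -[LHS]sapp_cmp -[RHS]sapp_cmp.
by rewrite (at_level_equivariant (phi e)).
Qed.

Definition spc_perm m (s : 'S_m) : hom (spc_level m) (spc_level m) :=
  desc (spc_level m) (spc_perm_cocone s).

Lemma spc_permE m (s : 'S_m) k i x :
  sapp (spc_perm s) k (sapp (spc_leg m i) k x) =
  sapp (spc_leg m i) k (sapp (perm_act (X i) s) k x).
Proof.
rewrite -!sapp_cmp.
by rewrite [_ \oc spc_leg m i](desc_leg (spc_level m) (spc_perm_cocone s) i).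
Qed.

Definition spc_sigma_leg m k (s : simplices circle k) i :
  phom (simplices (X i m) k) (simplices (spc_level m.+1) k).
Proof.
exists (fun x => sapp (spc_leg m.+1 i) k (sapp (sigma (X i) m) k (spair s x))).
by rewrite spair_ptr !sapp_pt.
Defined.

Lemma spc_sigma_cocone m k (s : simplices circle k) :
  @is_cocone pset_cat (eval_diagram (level_diagram m) k)
    (simplices (spc_level m.+1) k) (spc_sigma_leg m s).
Proof.
move=> e; apply: phomP => x.
change (sapp (spc_leg m.+1 (tgt e)) k
          (sapp (sigma (X (tgt e)) m) k (spair s (sapp (phi e m) k x))) =
        sapp (spc_leg m.+1 (src e)) k (sapp (sigma (X (src e)) m) k (spair s x))).
rewrite -spc_leg_edge; apply: congr1.
rewrite -[RHS]sapp_cmp (at_level_sigma (phi e)) sapp_cmp.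
by apply: congr1; rewrite smash_mapE.
Qed.

Definition spc_sigma_at m k (s : simplices circle k) :
  phom (simplices (spc_level m) k) (simplices (spc_level m.+1) k) :=
  pset_desc (@spc_sigma_cocone m k s).

Lemma spc_sigma_atE m k (s : simplices circle k) i x :
  spc_sigma_at m s (sapp (spc_leg m i) k x) =
  sapp (spc_leg m.+1 i) k (sapp (sigma (X i) m) k (spair s x)).
Proof.
exact: (congr1 (fun t : phom _ _ => t x)
  (desc_leg (pset_colimit (eval_diagram (level_diagram m) k))
     (@spc_sigma_cocone m k s) i)).
Qed.

Lemma spc_sigma_at_pt m k (q : simplices (spc_level m) k) :
  spc_sigma_at m pt q = pt.
Proof.
elim/spc_ind: q => [|i x]; first exact: pfun_pt.
by rewrite spc_sigma_atE spair_ptl !sapp_pt.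
Qed.

Definition spc_sigma m : hom (smash circle (spc_level m)) (spc_level m.+1).
Proof.
exists (fun k => smash_lift (f := fun s => spc_sigma_at m s)
              (@spc_sigma_at_pt m k) (fun s => pfun_pt (spc_sigma_at m s))).
move=> l k f; apply: phomP => q; have [s [x <-]] := spair_surj q.
rewrite [LHS](congr1 _ (psmash_mapE _ _ _ _)) [LHS]smash_liftE.
apply: esym; apply: etrans (congr1 (sact (spc_level m.+1) f)
  (smash_liftE (@spc_sigma_at_pt m l)
     (fun s => pfun_pt (spc_sigma_at m s)) s x)) _; apply: esym.
change (spc_sigma_at m (sact circle f s) (sact (spc_level m) f x) =
        sact (spc_level m.+1) f (spc_sigma_at m s x)).
elim/spc_ind: x => [|i x]; first by rewrite !pfun_pt.
by rewrite -sapp_nat !spc_sigma_atE -smash_sactE !sapp_nat.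
Defined.

Lemma spc_sigmaE m k s i x :
  sapp (spc_sigma m) k (spair s (sapp (spc_leg m i) k x)) =
  sapp (spc_leg m.+1 i) k (sapp (sigma (X i) m) k (spair s x)).
Proof. by rewrite [LHS]smash_liftE spc_sigma_atE. Qed.

Lemma spc_sigma_iterE k p m (s : 'I_p -> simplices circle k) i x :
  sigma_iter spc_sigma s (sapp (spc_leg m i) k x) =
  sapp (spc_leg (p + m) i) k (sigma_iter (sigma (X i)) s x).
Proof.
elim: p s => [|p IHp] s //=; rewrite IHp; exact: spc_sigmaE.
Qed.

Lemma spc_sigma_iter_pt k p m (s : 'I_p -> simplices circle k) :
  sigma_iter spc_sigma s (pt : simplices (spc_level m) k) = pt.
Proof.
elim: p s => [|p IHp] s //=; rewrite IHp spair_ptr.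
exact: (sapp_pt (spc_sigma (p + m)) k).
Qed.

Definition spectrum_colim : spectrum.
Proof.
exists (fun m => spc_level m : sSet) spc_perm spc_sigma.
- move=> m; apply: sSet_homP => k; apply: spc_ind; first by rewrite !sapp_pt.
  by move=> i x; rewrite spc_permE perm_act1.
- move=> m s t; apply: sSet_homP => k; apply: spc_ind.
    by rewrite !sapp_pt.
  by move=> i x; rewrite sapp_cmp !spc_permE perm_actM.
- move=> k p m t r s; apply: spc_ind => [|i x].
    by rewrite spc_sigma_iter_pt !sapp_pt spc_sigma_iter_pt.
  by rewrite spc_permE !spc_sigma_iterE spc_permE sigma_equivariant.
Defined.

Definition spectrum_leg (i : vert D) : spectrum_hom (X i) spectrum_colim.
Proof.
exists (fun m => spc_leg m i) => m *; apply: sSet_homP => k x.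
- by rewrite [RHS]sapp_cmp spc_permE.
- have [s [y <-]] := spair_surj x.
  by rewrite [RHS]sapp_cmp smash_mapE spc_sigmaE.
Defined.

Section Desc.
Variables (z : spectrum) (l : forall i, spectrum_hom (X i) z).
Hypothesis cl : @is_cocone Sp D z l.

Lemma level_cocone m : @is_cocone _ (level_diagram m) (z m) (fun i => l i m).
Proof. by move=> e /=; rewrite -(cl e). Qed.

Definition spectrum_desc_at m : hom (spc_level m) (z m) :=
  desc (spc_level m) (@level_cocone m).

Lemma spectrum_desc_atE m k i x :
  sapp (spectrum_desc_at m) k (sapp (spc_leg m i) k x) = sapp (l i m) k x.
Proof.
rewrite -sapp_cmp.
by rewrite [_ \oc spc_leg m i](desc_leg (spc_level m) (@level_cocone m) i).
Qed.

Definition spectrum_desc : spectrum_hom spectrum_colim z.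
Proof.
exists spectrum_desc_at => m.
- move=> s; apply: sSet_homP => k; apply: spc_ind; first by rewrite !sapp_pt.
  move=> i x; rewrite [LHS]sapp_cmp [RHS]sapp_cmp spc_permE.
  by rewrite !spectrum_desc_atE -!sapp_cmp at_level_equivariant.
- apply: sSet_homP => k q; have [s [y <-]] := spair_surj q.
  rewrite [LHS]sapp_cmp [RHS]sapp_cmp smash_mapE.
  elim/spc_ind: y => [|i x]; first by rewrite !sapp_pt !spair_ptr !sapp_pt.
  rewrite spc_sigmaE !spectrum_desc_atE -[LHS]sapp_cmp at_level_sigma.
  by rewrite sapp_cmp smash_mapE.
Defined.

End Desc.

Definition spectrum_colimit : colimit D.
Proof.
exists spectrum_colim spectrum_leg spectrum_desc.
- move=> e; apply: spectrum_homP => m; exact: (leg_cocone (spc_level m) e).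
- move=> z l cl i; apply: spectrum_homP => m.
  exact: (desc_leg (spc_level m) (@level_cocone z l cl m) i).
- move=> z u v uv; apply: spectrum_homP => m.
  apply: (desc_uniq (c := spc_level m)) => i.
  exact: (congr1 (fun t : spectrum_hom _ _ => t m) (uv i)).
Defined.

End SpectrumColimits.

Definition Sp_cocomplete : cocomplete Sp := spectrum_colimit.

(* [n : pos] stands for the object {1, ..., n} of Epi, encoded as ['I_n]. *)
Record pos := Pos { pos_val :> nat; pos_gt0 : 0 < pos_val }.

Definition pos1 : pos := @Pos 1 isT.
Definition pos_succ (n : pos) : pos := @Pos n.+1 isT.

Record epi (r n : nat) := EpiMap {
  epi_fun :> 'I_r -> 'I_n;
  epi_surj : forall j, exists i, epi_fun i = j }.

Lemma epiP r n (f g : epi r n) : (forall i, f i = g i) -> f = g.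
Proof.
case: f g => f fp [g gp] /= fg; have E : f = g by apply: funext.
by rewrite {}E in fp fg *; congr EpiMap; exact: Prop_irrelevance.
Qed.

Definition epi_id n : epi n n := @EpiMap n n id (fun j => ex_intro _ j erefl).

Definition epi_cmp m n p (g : epi n p) (f : epi m n) : epi m p.
Proof.
exists (g \o f) => k; have [j <-] := epi_surj g k.
by have [i <-] := epi_surj f j; exists i.
Defined.

Definition Epi : category.
Proof.
by exists pos (fun r n : pos => epi r n) (fun n => epi_id n)
  (fun m n p => @epi_cmp m n p) => *; apply: epiP.
Defined.

(* The structure maps of a right module M over Com = ( *, S, S, ...) amount to
   maps M(n) -> M(r), one for each surjection r ->> n (its fibres have r_1, ...,
   r_n >= 1 elements); M(0) = * is not recorded. *)
Definition RMod : category := presheaf Epi Sp.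

Definition RMod_cocomplete : cocomplete RMod :=
  functor_cat_cocomplete Sp_cocomplete.

(* The symmetric group as a one-object category; [s * t] is "first s, then t". *)
Definition BSigma (n : nat) : category.
Proof.
exists unit (fun _ _ => 'S_n) (fun _ => 1%g) (fun _ _ _ t s => (s * t)%g).
- by move=> *; rewrite mulgA.
- by move=> *; rewrite mulg1.
- by move=> *; rewrite mul1g.
Defined.

(* Spectra with a right action of the symmetric group of degree n, such as the
   terms M(n) of a right Com-module M. *)
Definition SigmaSp (n : nat) : category := presheaf (BSigma n) Sp.

Definition underlying n (X : SigmaSp n) : Sp := (X : functor _ _) tt.

Definition ract n (X : SigmaSp n) (s : 'S_n) :
  hom (underlying X) (underlying X) := @fmap (op (BSigma n)) Sp X tt tt s.

Definition underlying_map n (X Y : SigmaSp n) (f : hom X Y) :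
  hom (underlying X) (underlying Y) := (f : nat_trans _ _) tt.

Lemma underlying_map_ract n (X Y : SigmaSp n) (f : hom X Y) (s : 'S_n) :
  underlying_map f \oc ract X s = ract Y s \oc underlying_map f.
Proof. exact: (@naturality (op (BSigma n)) Sp _ _ f tt tt s). Qed.

Definition epi_perm n (s : 'S_n) : epi n n.
Proof. by exists s => j; exists ((s^-1)%g j); rewrite permKV. Defined.

Definition term (M : RMod) (r : pos) : Sp := (M : functor _ _) r.

Definition restrict (M : RMod) (r n : pos) (a : epi r n) :
  hom (term M n) (term M r) := @fmap (op Epi) Sp M n r a.

Definition term_map (M N : RMod) (f : hom M N) (r : pos) :
  hom (term M r) (term N r) := (f : nat_trans _ _) r.

Lemma restrict1 (M : RMod) (n : pos) : restrict M (epi_id n) = idm (term M n).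
Proof. exact: (@fmap1 (op Epi) Sp M n). Qed.

Lemma restrictM (M : RMod) (m r n : pos) (a : epi r n) (b : epi m r) :
  restrict M (r := m) (n := n) (epi_cmp a b) = restrict M b \oc restrict M a.
Proof. exact: (@fmapM (op Epi) Sp M n r m b a). Qed.

Lemma term_map_restrict (M N : RMod) (f : hom M N) (r n : pos) (a : epi r n) :
  term_map f r \oc restrict M a = restrict N a \oc term_map f n.
Proof. exact: (@naturality (op Epi) Sp _ _ f n r a). Qed.

Definition sigma_term (M : RMod) (n : pos) : SigmaSp n.
Proof.
exists (fun _ => term M n) (fun _ _ (s : 'S_n) => restrict M (epi_perm s)).
- move=> u; rewrite -restrict1; congr restrict.
  by apply: epiP => i /=; rewrite perm1.
- move=> u v w t s; rewrite -restrictM; congr restrict.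
  by apply: epiP => i /=; rewrite permM.
Defined.

Definition sigma_term_map (M N : RMod) (f : hom M N) (n : pos) :
  hom (sigma_term M n) (sigma_term N n).
Proof.
exists (fun _ => term_map f n) => u v s; exact: term_map_restrict.
Defined.

Section FreeModule.
Variable n : pos.

(* The r-th term X /\_{Sigma_n} (Epi(r, n)_+ /\ S) of the free module: the wedge
   of copies of X indexed by the surjections a : r ->> n, modulo the relations
   (x, s a) ~ (x s, a) for s in Sigma_n. *)
Definition tensor_diagram (X : SigmaSp n) (r : pos) : diagram Sp :=
  @Diagram Sp (epi r n) ('S_n * epi r n)
    (fun e => epi_cmp (epi_perm e.1) e.2) (fun e => e.2)
    (fun _ => underlying X) (fun e => ract X e.1).

Definition free_term (X : SigmaSp n) (r : pos) : colimit (tensor_diagram X r) :=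
  Sp_cocomplete (tensor_diagram X r).

Definition free_in (X : SigmaSp n) (r : pos) (a : epi r n) :
  hom (underlying X) (free_term X r) := leg (free_term X r) a.

Lemma free_in_act (X : SigmaSp n) (r : pos) (s : 'S_n) (a : epi r n) :
  free_in X a \oc ract X s = free_in X (r := r) (epi_cmp (epi_perm s) a).
Proof. exact: (leg_cocone (free_term X r) (s, a)). Qed.

Lemma free_restrict_cocone (X : SigmaSp n) (m r : pos) (b : epi m r) :
  @is_cocone _ (tensor_diagram X r) (free_term X m)
    (fun a => free_in X (r := m) (epi_cmp a b)).
Proof.
move=> [s a]; apply: etrans (free_in_act X (r := m) s (epi_cmp a b)) _.
by congr free_in; apply: epiP.
Qed.

Definition free_restrict (X : SigmaSp n) (m r : pos) (b : epi m r) :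
  hom (free_term X r) (free_term X m) :=
  desc (free_term X r) (@free_restrict_cocone X m r b).

Lemma free_restrictE (X : SigmaSp n) (m r : pos) (b : epi m r) (a : epi r n) :
  free_restrict X b \oc free_in X a = free_in X (r := m) (epi_cmp a b).
Proof. exact: (desc_leg (free_term X r) (@free_restrict_cocone X m r b) a). Qed.

Lemma free_term_eq (X : SigmaSp n) (r : pos) (z : Sp)
    (u v : hom (free_term X r) z) :
  (forall a : epi r n, u \oc free_in X a = v \oc free_in X a) -> u = v.
Proof. exact: (desc_uniq (c := free_term X r)). Qed.

(* The free right module i_n(X) o Com. *)
Definition free_module (X : SigmaSp n) : RMod.
Proof.
exists (fun r : op Epi => free_term X r : Sp)
       (fun (r m : op Epi) (b : epi m r) => free_restrict X b).
- move=> r; apply: free_term_eq => a.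
  by rewrite free_restrictE cmp1m; congr free_in; apply: epiP.
- move=> p r m b c; apply: free_term_eq => a.
  rewrite [LHS]free_restrictE -cmpA free_restrictE free_restrictE.
  by congr free_in; apply: epiP.
Defined.

Lemma free_module_map_cocone (X Y : SigmaSp n) (f : hom X Y) (r : pos) :
  @is_cocone _ (tensor_diagram X r) (free_term Y r)
    (fun a => free_in Y a \oc underlying_map f).
Proof.
move=> [s a].
change (free_in Y a \oc underlying_map f \oc ract X s =
        free_in Y (r := r) (epi_cmp (epi_perm s) a) \oc underlying_map f).
rewrite -cmpA underlying_map_ract cmpA.
by congr (_ \oc _); exact: free_in_act.
Qed.

Definition free_module_map (X Y : SigmaSp n) (f : hom X Y) :
  hom (free_module X) (free_module Y).
Proof.
exists (fun r : op Epi => desc (free_term X r) (@free_module_map_cocone X Y f r)).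
move=> r m b; apply: free_term_eq => a.
have E k c := desc_leg (free_term X k) (@free_module_map_cocone X Y f k) c.
apply: etrans (_ : free_in Y (r := m) (epi_cmp a b) \oc underlying_map f = _).
  rewrite -cmpA [_ \oc free_in X a]free_restrictE; exact: E.
rewrite -[RHS]cmpA -free_restrictE -cmpA; congr (_ \oc _).
by apply: esym; exact: E.
Defined.

Lemma eval_cocone (M : RMod) (r : pos) :
  @is_cocone _ (tensor_diagram (sigma_term M n) r) (term M r)
    (fun a => restrict M a).
Proof. by move=> [s a]; rewrite [RHS]restrictM. Qed.

(* The map e_n : i_n(M(n)) o Com -> M. *)
Definition eval_map (M : RMod) : hom (free_module (sigma_term M n)) M.
Proof.
exists (fun r : op Epi => desc (free_term (sigma_term M n) r) (@eval_cocone M r)).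
move=> r m b; apply: free_term_eq => a.
have E k c := desc_leg (free_term (sigma_term M n) k) (@eval_cocone M k) c.
apply: etrans (_ : restrict M (r := m) (n := n) (epi_cmp a b) = _).
  rewrite -cmpA [_ \oc free_in _ a]free_restrictE; exact: E.
by rewrite restrictM -cmpA; congr (_ \oc _); apply: esym; exact: E.
Defined.

Lemma eval_mapE (M : RMod) (r : pos) (a : epi r n) :
  term_map (eval_map M) r \oc free_in (sigma_term M n) a = restrict M a.
Proof.
exact: (desc_leg (free_term (sigma_term M n) r) (@eval_cocone M r) a).
Qed.

(* e_n extends the identity of M(n), included along the identity of n. *)
Lemma eval_map_unit (M : RMod) :
  term_map (eval_map M) n \oc free_in (sigma_term M n) (r := n) (epi_id n) =
  idm (term M n).
Proof. by rewrite eval_mapE restrict1. Qed.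

Lemma eval_map_nat (M N : RMod) (f : hom M N) :
  f \oc eval_map M = eval_map N \oc free_module_map (sigma_term_map f n).
Proof.
apply: nat_transP => r; apply: free_term_eq => a.
have E K := desc_leg (free_term (sigma_term K n) r) (@eval_cocone K r) a.
have F := desc_leg (free_term (sigma_term M n) r)
            (@free_module_map_cocone _ _ (sigma_term_map f n) r) a.
apply: etrans (_ : term_map f r \oc restrict M a = _).
  by rewrite -[LHS]cmpA; congr (_ \oc _); exact: E.
rewrite term_map_restrict -[RHS]cmpA; apply: esym.
apply: etrans (congr1 (fun t => cmp _ t) F) _.
by rewrite [LHS]cmpA; congr (_ \oc _); exact: E.
Qed.

End FreeModule.

Section Filtration.
Variable M : RMod.

Record stage := Stage { stage_mod : RMod; stage_map : hom stage_mod M }.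

Section Step.
Variables (n : pos) (S : stage).
Let F := stage_mod S.
Let g : hom F M := stage_map S.

(* For S = (F_(n-1) M, g_(n-1)), the pushout of
   i_n(M(n)) o Com <- i_n((F_(n-1) M)(n)) o Com -> F_(n-1) M. *)
Definition step_mod : RMod :=
  pushout RMod_cocomplete
    (free_module_map (sigma_term_map g n)) (eval_map n F).

Definition step_in : hom F step_mod := po_inr RMod_cocomplete _ _.

Definition step_map : hom step_mod M :=
  po_desc RMod_cocomplete (esym (eval_map_nat n g)).

Definition step : stage := Stage step_map.

Lemma step_map_in : step_map \oc step_in = g.
Proof. exact: po_desc_inr. Qed.

End Step.

(* [filt_stage k] is the pair (F_(k+1) M, g_(k+1)), so that [filt n] is F_n M. *)
Fixpoint filt_stage (k : nat) : stage :=
  match k with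
  | 0 => Stage (eval_map pos1 M)
  | k'.+1 => step (@Pos k'.+2 isT) (filt_stage k')
  end.

Definition filt (n : pos) : RMod := stage_mod (filt_stage n.-1).

Definition filt_g (n : pos) : hom (filt n) M := stage_map (filt_stage n.-1).

Definition filt_f (n : pos) : hom (filt n) (filt (pos_succ n)).
Proof. by case: n => [[|k] // k0]; exact: step_in. Defined.

Lemma filt_g_f (n : pos) : filt_g (pos_succ n) \oc filt_f n = filt_g n.
Proof. by case: n => [[|k] // k0]; exact: step_map_in. Qed.

End Filtration.

(* Main.v *)
Require Import Defs.
From mathcomp Require Import all_boot all_fingroup.

(** Pushouts of right modules are computed termwise. In degrees r < n there is
    no surjection r ->> n, so the free modules on degree n vanish there and the
    n-th step changes nothing. In degree n the map e_n is an isomorphism for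
    every module, since every surjection n ->> n is a permutation; hence the
    n-th step replaces (F_(n-1) M)(n) by M(n). *)

Set Implicit Arguments.
Unset Strict Implicit.
Unset Printing Implicit Defensive.

Local Open Scope cat_scope.

Section Isomorphisms.
Variable C : category.

Lemma is_iso_cmp_cancelr (a b c : C) (g : hom b c) (f : hom a b) :
  is_iso f -> is_iso (g \oc f) -> is_iso g.
Proof.
move=> [f' [f'f ff']] [h [hgf gfh]]; exists (f \oc h); split; last first.
  by rewrite cmpA.
by rewrite -[LHS]cmpm1 -[in LHS]ff' !cmpA -(cmpA _ g f) -(cmpA f) hgf cmpm1.
Qed.

(** The universal property is kept as a predicate because evaluating a span of functors at an object
    gives a diagram that is not convertible to the [span_diagram] of the values. *)
Definition is_pushout (a b c p : C) (u : hom a b) (v : hom a c)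
    (i : hom b p) (j : hom c p) : Prop :=
  [/\ i \oc u = j \oc v,
      forall (z : C) (f : hom b z) (g : hom c z), f \oc u = g \oc v ->
        exists h : hom p z, h \oc i = f /\ h \oc j = g
    & forall (z : C) (s t : hom p z),
        s \oc i = t \oc i -> s \oc j = t \oc j -> s = t].

Lemma is_pushout_sym (a b c p : C) (u : hom a b) (v : hom a c)
    (i : hom b p) (j : hom c p) :
  is_pushout u v i j -> is_pushout v u j i.
Proof.
move=> [ij ex un]; split=> // [z f g fg|z s t *]; last exact: un.
by have [h []] := ex z g f (esym fg); exists h.
Qed.

Lemma is_pushout_iso (a b c p : C) (u : hom a b) (v : hom a c)
    (i : hom b p) (j : hom c p) :
  is_pushout u v i j -> is_iso u -> is_iso j.
Proof.
move=> [ij ex un] [u' [u'u uu']].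
(* The inverse of [j] is induced by [v \oc u'] and the identity of [c]. *)
have [|h [hi hj]] := ex c (v \oc u') (Defs.idm c).
  by rewrite -cmpA u'u cmpm1 cmp1m.
exists h; split=> //; apply: un; rewrite -cmpA ?hi ?hj cmp1m ?cmpm1 //.
by rewrite cmpA -ij -cmpA uu' cmpm1.
Qed.

End Isomorphisms.

Lemma functor_pushout_at (C D : category) (hD : cocomplete D)
    (X Y Z : functor_cat C D) (u : hom X Y) (v : hom X Z) (x : C) :
  is_pushout ((u : nat_trans _ _) x) ((v : nat_trans _ _) x)
    ((po_inl (functor_cat_cocomplete hD) u v : nat_trans _ _) x)
    ((po_inr (functor_cat_cocomplete hD) u v : nat_trans _ _) x).
Proof.
split.
- exact: (congr1 (fun t : nat_trans _ _ => t x)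
            (po_comm (functor_cat_cocomplete hD) u v)).
- move=> z f g fg.
  pose l (i : option bool) :
      hom ((span_ob X Y Z i : functor C D) x) z :=
    match i with None => f \oc (u : nat_trans _ _) x
               | Some true => f | Some false => g end.
  have cl : @is_cocone D (eval_diagram (span_diagram u v) x) z l by case.
  exists (desc (hD (eval_diagram (span_diagram u v) x)) cl).
  have E i := desc_leg (hD (eval_diagram (span_diagram u v) x)) cl i.
  by split; [exact: (E (Some true)) | exact: (E (Some false))].
- move=> z s t el er.
  apply: (desc_uniq (c := hD (eval_diagram (span_diagram u v) x))) => -[[]|] //.
  (* Only the apex of the span is left; its leg factors through the leg of [Y]. *)
  have E := leg_cocone (hD (eval_diagram (span_diagram u v) x)) true.
  apply: etrans (congr1 (cmp s) (esym E)) _.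
  apply: etrans _ (congr1 (cmp t) E).
  by rewrite !cmpA; congr (_ \oc _).
Qed.

(** This count excludes surjections when [r < n] and makes them injective when [r = n]. *)
Lemma card_codom_epi (r n : nat) (a : epi r n) : #|codom a| = n.
Proof.
rewrite -[RHS]card_ord; apply: eq_card => j.
by have [i <-] := epi_surj a j; rewrite codom_f.
Qed.

Lemma eval_map_iso (n : pos) (M : RMod) : is_iso (term_map (eval_map n M) n).
Proof.
exists (free_in (sigma_term M n) (r := n) (epi_id n)).
split; last exact: eval_map_unit.
apply: free_term_eq => a; rewrite -cmpA eval_mapE cmp1m.
have a_inj : injective a.
  have /image_injP inj_a : #|codom a| == #|'I_n| by rewrite card_codom_epi card_ord.
  by move=> i j; exact: inj_a.
have <- : epi_perm (perm a_inj) = a by apply: epiP => i /=; rewrite permE.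
(* The tensor relation over the symmetric group moves the permutation from the index to [M(n)]. *)
apply: etrans (free_in_act (sigma_term M n) (r := n) (perm a_inj) (epi_id n)) _.
by congr free_in; apply: epiP.
Qed.

(** Both terms are colimits of empty diagrams, hence initial. *)
Lemma free_module_map_iso_lt (n r : pos) (X Y : SigmaSp n) (f : hom X Y) :
  r < n -> is_iso (term_map (free_module_map f) r).
Proof.
move=> ltrn.
have no_epi (a : epi r n) : False.
  have := leq_image_card a 'I_r.
  by rewrite card_codom_epi card_ord leqNgt ltrn.
have cl : @is_cocone _ (tensor_diagram Y r) (free_term X r)
    (fun a => False_rect _ (no_epi a)) by move=> [s a]; case: (no_epi a).
by exists (desc (free_term Y r) cl); split; apply: free_term_eq => a;
  case: (no_epi a).
Qed.

(** In degree [r], [step_in] is a cobase change of an isomorphism, and [step_map] composed with it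
    is the previous map to [M]. *)
Lemma step_map_iso_lt (M : RMod) (n r : pos) (S : stage M) :
  r < n -> is_iso (term_map (stage_map S) r) ->
  is_iso (term_map (step_map n S) r).
Proof.
move=> ltrn gr; apply: (@is_iso_cmp_cancelr _ _ _ _ _ (term_map (step_in n S) r)).
  apply: is_pushout_iso (functor_pushout_at _ _ _ _) _.
  exact: free_module_map_iso_lt.
by have /(congr1 (fun t => term_map t r)) E := step_map_in n S; rewrite -E in gr.
Qed.

(** Here the other leg is used: [po_inl] is a cobase change of [e_n] for the previous stage, and
    [step_map] composed with it is [e_n] for [M]. *)
Lemma step_map_iso_eq (M : RMod) (n : pos) (S : stage M) :
  is_iso (term_map (step_map n S) n).
Proof.
pose u := free_module_map (sigma_term_map (stage_map S) n).
pose v := eval_map n (stage_mod S).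
apply: (@is_iso_cmp_cancelr _ _ _ _ _ (term_map (po_inl RMod_cocomplete u v) n)).
  apply: is_pushout_iso (is_pushout_sym (functor_pushout_at _ _ _ _)) _.
  exact: eval_map_iso.
have E : step_map n S \oc po_inl RMod_cocomplete u v = eval_map n M.
  exact: po_desc_inl.
have := eval_map_iso n M; by rewrite -E.
Qed.

Lemma pos_inj (m n : pos) : m = n :> nat -> m = n.
Proof.
case: m n => m hm [n hn] /= E; case: _ / E in hn *.
by congr Pos; exact: bool_irrelevance.
Qed.

Lemma filt_stage_iso (M : RMod) (k : nat) (r : pos) :
  r <= k.+1 -> is_iso (term_map (stage_map (filt_stage M k)) r).
Proof.
elim: k => [|k IHk] ler /=.
  (* Stage 0 is [F_1 M], and degrees start at 1. *)
  have -> : r = pos1 by apply: pos_inj; apply/eqP; rewrite eqn_leq ler pos_gt0.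
  exact: eval_map_iso.
have [ltr|ger] := ltnP r k.+2.
  by apply: step_map_iso_lt => //; exact: IHk.
have -> : r = @Pos k.+2 isT by apply: pos_inj; apply/eqP; rewrite eqn_leq ler.
exact: step_map_iso_eq.
Qed.

Theorem proposition7p2 (M : RMod) (n r : pos) (hrn : r <= n) :
  is_iso (term_map (filt_g M n) r).
Proof. by apply: filt_stage_iso; rewrite prednK // pos_gt0. Qed.
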